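(* Let $q$ be a prime power and let $n,m,h$ be positive integers with $m\geq 3$ and $2\leq h\leq n-2$. Let $\mathbf{A}=(\alpha_1,\dots,\alpha_m)\in(\mathbb{F}_{q^n}^* )^m$ be such that (i) $K_{\mathbf{A}}:=\alpha_1^{q^{m-1}}\alpha_2\alpha_3^{q}\cdots\alpha_m^{q^{m-2}}$ is not a $(1+q+\cdots+q^{m-1})$-th power in $\mathbb{F}_{q^n}$, and (ii) for every $\delta=1,\dots,m-1$, the element $\Pi_{\delta+2}/\Pi_2$ is not a $(q^m-1)$-th power in $\mathbb{F}_{q^n}$, where $\Pi_i:=\alpha_i^{q^{m-1}}\alpha_{i-1}^{q^{m-2}}\cdots\alpha_{i+2}^{q}\alpha_{i+1}$ with indices of the $\alpha$'s taken modulo $m$ in $\{1,\dots,m\}$. Then for every $s=2,\dots,m-2$ the $\mathbb{F}_q$-subspace $$V_{\mathbf{A},h}:=\{(\underline{x},\underline{x}^q,\dots,\underline{x}^{q^{h-1}},f_1(\underline{x}),\dots,f_m(\underline{x})):\underline{x}\in\mathbb{F}_{q^n}^m\}\subseteq\mathbb{F}_{q^n}^{m(h+1)},$$ where $f_i(\underline{x})=x_i^{q^h}+\alpha_{i+1}x_{i+1}^{q^{h+1}}$ for $i=1,\dots,m-1$ and $f_m(\underline{x})=x_m^{q^h}+\alpha_1x_1^{q^{h+1}}$, is $\big(m(h+1)-s(h+1),\ mn-(s+1)(n-h-1)\big)$-evasive.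
   Context: For $\underline{x}=(x_1,\dots,x_m)$, $\underline{x}^{q^j}=(x_1^{q^j},\dots,x_m^{q^j})$. An element $y\in\mathbb{F}_{q^n}$ is an $e$-th power if $y=z^e$ for some $z\in\mathbb{F}_{q^n}$. Let $a<k$ and $a\leq r$ be positive integers. An $\mathbb{F}_q$-subspace $U\subseteq\mathbb{F}_{q^n}^k$ is $(a,r)$-evasive if for every $a$-dimensional $\mathbb{F}_{q^n}$-subspace $H\subseteq\mathbb{F}_{q^n}^k$ one has $\dim_{\mathbb{F}_q}(U\cap H)\leq r$. *)

(* Defs.v *)
From HB Require Import structures.
From mathcomp Require Import all_boot all_order all_algebra all_solvable all_field.

Set Implicit Arguments.
Unset Strict Implicit.
Unset Printing Implicit Defensive.

Import GRing.Theory.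
Local Open Scope ring_scope.

Definition is_power (R : nzSemiRingType) (e : nat) (y : R) : Prop :=
  exists z : R, y = z ^+ e.

(* x_i for a 1-based index i read modulo m, so that x_{m+1} = x_1; the value 0
   is only taken when m = 0. *)
Definition entry (V : nmodType) (m : nat) (x : {ffun 'I_m -> V}) (i : nat) : V :=
  oapp x 0 (insub ((i + m).-1 %% m)%N).

(* For L / F a finite extension, L^k is represented by {ffun 'I_k -> L}, whose
   vector space structure is the one over F. Spaces over L live in 'rV[L]_k. *)
Section Evasive.

Variables (F : fieldType) (L : fieldExtType F) (k : nat).

Definition row_of (v : {ffun 'I_k -> L}) : 'rV[L]_k := \row_i v i.

(* Restriction of scalars of H from L to F; see mem_restrict_scalars. *)
Definition restrict_scalars (H : {vspace 'rV[L]_k}) :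
    {vspace {ffun 'I_k -> L}} :=
  <<[seq [ffun i => (c * w ord0 i)%R] | c : L <- vbasis {:L},
                                          w : 'rV[L]_k <- vbasis H]>>%VS.

Lemma mem_restrict_scalars (H : {vspace 'rV[L]_k}) (v : {ffun 'I_k -> L}) :
  (v \in restrict_scalars H) = (row_of v \in H).
Proof.
apply/idP/idP => [|Hv].
  rewrite /restrict_scalars; set s := (X in <<X>>%VS) => vs.
  pose X := in_tuple s.
  rewrite (coord_span (vs : v \in <<X>>%VS)).
  have -> : row_of (\sum_i coord X i v *: X`_i)
            = \sum_i (coord X i v)%:A *: row_of X`_i.
    apply/rowP => j; rewrite mxE sum_ffunE summxE; apply: eq_bigr => i _.
    by rewrite !mxE ffunE mulr_algl.
  apply: memv_suml => i _; apply: memvZ.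
  have /allpairsP [[c w] /= [_ wH ->]] := mem_nth 0 (ltn_ord i : (i < size s)%N).
  have -> : row_of [ffun i => c * w ord0 i] = c *: w.
    by apply/rowP => j; rewrite !mxE ffunE.
  exact: memvZ (vbasis_mem wH).
have -> : v = \sum_i \sum_j coord (vbasis {:L}) j (coord (vbasis H) i (row_of v))
    *: [ffun l => (vbasis {:L})`_j * (vbasis H)`_i ord0 l].
  apply/ffunP => l; rewrite sum_ffunE.
  have := congr1 (fun u : 'rV[L]_k => u ord0 l) (coord_vbasis Hv).
  rewrite mxE summxE => ->; apply: eq_bigr => i _.
  rewrite mxE sum_ffunE.
  rewrite {1}(coord_vbasis (memvf (coord (vbasis H) i (row_of v)))) mulr_suml.
  by apply: eq_bigr => j _; rewrite !ffunE scalerAl.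
apply: memv_suml => i _; apply: memv_suml => j _; apply/memvZ/memv_span.
apply/allpairsP; exists ((vbasis {:L})`_j, (vbasis H)`_i).
by split=> //=; apply: mem_nth; rewrite size_tuple.
Qed.

Definition evasive (a r : nat) (U : {vspace {ffun 'I_k -> L}}) : Prop :=
  [/\ (0 < a)%N, (a < k)%N, (a <= r)%N &
      forall H : {vspace 'rV[L]_k},
        \dim H = a -> (\dim (U :&: restrict_scalars H)%VS <= r)%N].

End Evasive.

Section Construction.

Variables (F : finFieldType) (L : fieldExtType F) (m : nat).
Variable alpha : {ffun 'I_m -> L}.

Local Notation q := #|F|.

(* K_A = alpha_1^{q^{m-1}} alpha_2 alpha_3^q ... alpha_m^{q^{m-2}} *)
Definition K_ : L :=
  entry alpha 1 ^+ (q ^ (m - 1)) *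
  \prod_(2 <= i < m.+1) entry alpha i ^+ (q ^ (i - 2)).

(* Pi_i = alpha_{i+1} alpha_{i+2}^q ... alpha_{i+m}^{q^{m-1}}, alpha_{i+m} = alpha_i *)
Definition Pi_ (i : nat) : L :=
  \prod_(1 <= j < m.+1) entry alpha (i + j) ^+ (q ^ (j - 1)).

Variable h : nat.

Definition f_ (i : nat) (x : {ffun 'I_m -> L}) : L :=
  entry x i ^+ (q ^ h) + entry alpha i.+1 * entry x i.+1 ^+ (q ^ h.+1).

(* The coordinate t = j * m + (i - 1), 1 <= i <= m, is the i-th coordinate of
   the j-th block, the blocks being x, x^q, ..., x^{q^{h-1}}, f(x). *)
Definition V_vec (x : {ffun 'I_m -> L}) : {ffun 'I_(m * h.+1) -> L} :=
  [ffun t : 'I_(m * h.+1) =>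
     let j := (t %/ m)%N in let i := (t %% m).+1 in
     if (j < h)%N then entry x i ^+ (q ^ j) else f_ i x].

Fact entry_linear i : linear (fun x : {ffun 'I_m -> L} => entry x i).
Proof.
move=> c x y; rewrite /entry; case: insubP => [j _ _|_] /=.
  by rewrite !ffunE.
by rewrite scaler0 addr0.
Qed.

Fact frobenius_linear j : linear (fun y : L => y ^+ (q ^ j)).
Proof.
have [p p_pr charFp] := finPcharP F.
have charLp : p \in [pchar L] by rewrite pchar_lalg.
have qP : [pchar L].-nat (q ^ j)%N.
  rewrite pnatX (eq_pnat _ (pcharf_eq charLp)) -cardsT.
  by apply/orP; left; case/and3P: (fin_ring_pchar_abelem charFp).
move=> c x y; rewrite exprDn_pchar // exprZn; congr (_ *: _ + _).
elim: j {qP} => [|j IHj]; first by rewrite expn0 expr1.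
by rewrite expnS exprM expf_card.
Qed.

Fact V_vec_linear : linear V_vec.
Proof.
move=> c x y; apply/ffunP => t; rewrite !ffunE /f_ !entry_linear.
rewrite !frobenius_linear; case: ifP => // _.
by rewrite mulrDr scalerDr -scalerAr addrACA.
Qed.

HB.instance Definition _ := GRing.isLinear.Build F
  {ffun 'I_m -> L} {ffun 'I_(m * h.+1) -> L} *:%R V_vec V_vec_linear.

Definition V_ : {vspace {ffun 'I_(m * h.+1) -> L}} := limg (linfun V_vec).

Lemma V_P (v : {ffun 'I_(m * h.+1) -> L}) :
  reflect (exists x, v = V_vec x) (v \in V_).
Proof.
apply: (iffP memv_imgP) => [[x _ ->]|[x ->]]; exists x; by rewrite ?lfunE ?memvf.
Qed.

End Construction.

(* Main.v *)
From HB Require Import structures.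
Require Import Defs.
From mathcomp Require Import all_boot all_order all_algebra all_field.
From mathcomp Require Import perm zify ring.

Set Implicit Arguments.
Unset Strict Implicit.
Unset Printing Implicit Defensive.

Import GRing.Theory.
Local Open Scope ring_scope.

(* Fix H with dim H = t (h + 1), t = m - s, and let Y be the m x e matrix whose
   columns are an F-basis of the preimage of H. Let Y_j be its entrywise q^j-th
   power, S_j the row space of Y_0, ..., Y_{j-1}, and r_j = rank S_j. Then r_j
   is concave in j, r_n = e by Galois descent, and the vectors of V in H say that
   W = S_h + rows (Y_h + B Y_{h+1}) has rank at most t (h + 1), where B is
   the alpha-weighted cyclic shift. If r_{h+2} - r_{h+1} < t, concavity gives
   e <= m (h + 1) + (n - h - 1)(t - 1), which is the required bound. Otherwise
   all ranks are forced: the left kernel N of Y_h, of dimension s, is also that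
   of Y_h + B Y_{h+1}, so that N is invariant under the semilinear map
   c |-> (c_{i+1}^q / alpha_{i+1})_i. The m-th iterate of that map is diagonal,
   c |-> (c_i^{q^m} / Pi_i)_i; comparing c with its image for c of minimal
   weight in N, the hypothesis on the Pi_i makes this weight 1, hence N = L^m, which
   contradicts s < m. *)

(** * Nonzero vectors of minimal weight in a row space *)

Section MinimalWeight.

Variables (K : fieldType) (n : nat).
Implicit Types c d : 'rV[K]_n.

Definition weight c := #|[pred i | c 0 i != 0]|.

Definition min_weight p (N : 'M[K]_(p, n)) c :=
  [/\ (c <= N)%MS, c != 0 &
      forall d, (d <= N)%MS -> d != 0 -> (weight c <= weight d)%N].

(** The minimum is taken over the finitely many sets [A] whose coordinate subspace [D A] meets [N]
    nontrivially, a decidable condition even over an infinite field. *)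
Lemma min_weight_exists p (N : 'M[K]_(p, n)) :
  N != 0 -> exists c, min_weight N c.
Proof.
move=> N0; pose D (A : {set 'I_n}) : 'M[K]_n := diag_mx (\row_i (i \in A)%:R).
have subD (d : 'rV[K]_n) (A : {set 'I_n}) :
    (forall i, d 0 i != 0 -> i \in A) -> (d <= D A)%MS.
  move=> dA; apply/submxP; exists d; apply/rowP => i; rewrite mul_mx_diag !mxE.
  case: (boolP (i \in A)) => [_|iA]; first by rewrite mulr1.
  by rewrite mulr0; apply: contraNeq iA => /dA.
pose P (A : {set 'I_n}) := (N :&: D A)%MS != 0.
have PT : P setT.
  apply: contraNneq N0 => NT; apply/eqP/row_matrixP => i; rewrite row0.
  apply/eqP; rewrite -submx0 -NT sub_capmx row_sub subD // => j _.
  by rewrite inE.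
case: (arg_minnP (fun A : {set 'I_n} => #|A|) PT) => A PA minA.
have /rowV0Pn [c cNA c0] := PA.
have [cN /submxP [u cD]] := andP (etrans (esym (sub_capmx _ _ _)) cNA).
exists c; split=> // d dN d0.
have cA i : c 0 i != 0 -> i \in A.
  by rewrite cD mul_mx_diag !mxE; case: (i \in A); rewrite // mulr0 eqxx.
apply: (@leq_trans #|A|).
  by apply/subset_leq_card/subsetP => i; rewrite inE => /cA.
rewrite (leq_trans (minA [set i | d 0 i != 0] _)) ?cardsE //.
apply: contraNneq d0 => ND; rewrite -submx0 -ND sub_capmx dN subD // => i.
by rewrite inE.
Qed.

(* Otherwise cancelling the i-th entry of d against c would lower the weight. *)
Lemma min_weight_proportional p (N : 'M[K]_(p, n)) c d i :
    min_weight N c -> c 0 i != 0 -> (d <= N)%MS ->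
    (forall j, c 0 j = 0 -> d 0 j = 0) ->
  d = (d 0 i / c 0 i) *: c.
Proof.
move=> [cN _ cmin] ci dN dc; apply/eqP; rewrite -subr_eq0.
set b := d - _; apply: contraT => b0.
have bN : (b <= N)%MS by rewrite addmx_sub // eqmx_opp scalemx_sub.
have := cmin b bN b0; rewrite leqNgt => /negP []; apply/proper_card/properP.
split; last first.
  by exists i; rewrite !inE // !mxE divfK // subrr eqxx.
apply/subsetP => j; rewrite !inE; apply: contraNneq => cj.
by rewrite !mxE (dc j cj) cj mulr0 subrr.
Qed.

End MinimalWeight.

(** * Sums of semilinear twists of a matrix and their ranks *)

Section Twists.

Variables (K : fieldType) (sigma : {rmorphism K -> K}) (m e : nat).
Implicit Types Y : 'M[K]_(m, e).

Definition twist j Y := iter j (map_mx sigma) Y.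

Fixpoint twist_span j Y : 'M[K]_e :=
  if j is i.+1 then (twist_span i Y + twist i Y)%MS else 0.

Lemma mxrank_twist j Y : \rank (twist j Y) = \rank Y.
Proof. by elim: j => //= j <-; rewrite mxrank_map. Qed.

Lemma twist_sub_span i j Y : (i < j)%N -> (twist i Y <= twist_span j Y)%MS.
Proof.
elim: j => // j IHj; rewrite ltnS leq_eqVlt => /orP [/eqP ->|/IHj ij] /=.
  exact: addsmxSr.
exact: submx_trans ij (addsmxSl _ _).
Qed.

Lemma twist_span_sub p j Y (W : 'M[K]_(p, e)) :
  (forall i, (i < j)%N -> (twist i Y <= W)%MS) -> (twist_span j Y <= W)%MS.
Proof.
elim: j => [|j IHj] YW /=; first exact: sub0mx.
by rewrite addsmx_sub IHj ?YW // => i /leqW /YW.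
Qed.

Lemma twist_spanS_map j Y :
  (twist_span j.+1 Y == Y + map_mx sigma (twist_span j Y))%MS.
Proof.
have E : ((map_mx sigma (twist_span j Y)) <= twist_span j.+1 Y)%MS.
  elim: j => [|j IHj] /=; first by rewrite map_mx0 sub0mx.
  rewrite map_addsmx addsmx_sub (submx_trans IHj) ?addsmxSl //=.
  exact: addsmxSr.
apply/andP; split; last by rewrite addsmx_sub E (@twist_sub_span 0).
apply: twist_span_sub => -[|i] ij; first exact: addsmxSl.
apply: submx_trans (addsmxSr _ _); rewrite /= map_submx.
exact: twist_sub_span.
Qed.

(** Modular rank formula for [B] and its image under [sigma]: their sum contains the next span,
    their intersection contains the image of the previous one, and [sigma] preserves ranks. *)
Lemma mxrank_twist_span_concave j Y :
  (\rank (twist_span j.+2 Y) + \rank (twist_span j Y) <=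
   (\rank (twist_span j.+1 Y)).*2)%N.
Proof.
have := eqmxP (twist_spanS_map j.+1 Y).
have := eqmxP (twist_spanS_map j Y).
set A := twist_span j Y; set B := twist_span j.+1 Y => Bdef ->.
have AB : (map_mx sigma A <= B)%MS by rewrite Bdef addsmxSr.
have : (\rank (map_mx sigma A) <= \rank (B :&: map_mx sigma B)%MS)%N.
  by rewrite mxrankS // sub_capmx AB map_submx addsmxSl.
have : (\rank (Y + map_mx sigma B)%MS <= \rank (B + map_mx sigma B)%MS)%N.
  by rewrite mxrankS // addsmxS // Bdef addsmxSl.
have := mxrank_sum_cap B (map_mx sigma B); rewrite !mxrank_map; lia.
Qed.

End Twists.

(** * Concave sequences of natural numbers *)

Section ConcaveSequence.

Variable r : nat -> nat.
Hypothesis r_concave : forall j, (r j.+2 + r j <= (r j.+1).*2)%N.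

Lemma concave_step i k : (r (i + k).+1 + r i <= r (i + k) + r i.+1)%N.
Proof.
elim: k => [|k IHk]; first by rewrite addn0 addnC.
by have := r_concave (i + k); rewrite addnS; lia.
Qed.

(** No increment after [i] exceeds the one at [i]; the hypothesis makes the truncated subtraction
    exact. *)
Lemma concave_upper i k :
  (r i <= r i.+1)%N -> (r (i + k) <= r i + k * (r i.+1 - r i))%N.
Proof.
move=> ri; elim: k => [|k IHk]; first by rewrite addn0 leq_addr.
by have := concave_step i k; rewrite addnS mulSn; lia.
Qed.

(** Increments never grow, so an increment of at least [d] at [k] forces the same at every earlier
    place. *)
Lemma concave_lower k d :
  (r k + d <= r k.+1)%N -> forall i j, (i + j <= k.+1)%N ->
  (r i + j * d <= r (i + j))%N.
Proof.
move=> rk i; elim=> [|j IHj] ijk; first by rewrite mul0n !addn0.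
have {}IHj : (r i + j * d <= r (i + j))%N by apply: IHj; lia.
have := concave_step (i + j) (k - (i + j)).
by rewrite subnKC ?addnS ?mulSn; lia.
Qed.

End ConcaveSequence.

(** * Rank bound when the increment at h + 1 is small *)

Section TwistSpanBound.

Variables (K : fieldType) (sigma : {rmorphism K -> K}) (m e h : nat).
Variable Y : 'M[K]_(m, e).
Local Notation S j := (twist_span sigma j Y).

(** The first h + 1 increments are at most [\rank Y], hence at most [m]; by concavity all later ones
    are at most [t]. *)
Lemma mxrank_twist_span_bound n t :
    (h < n)%N -> (\rank (S h.+2) <= \rank (S h.+1) + t)%N ->
  (\rank (S n) <= m * h.+1 + (n - h.+1) * t)%N.
Proof.
move=> hn St.
have conc j := mxrank_twist_span_concave sigma j Y.
have r0 : \rank (S 0%N) = 0%N by rewrite mxrank0.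
have r1 : \rank (S 1%N) = \rank Y by rewrite /= adds0mx.
have mono : (\rank (S h.+1) <= \rank (S h.+2))%N by rewrite mxrankS ?addsmxSl.
have := concave_upper conc (n - h.+1) mono; rewrite subnKC //.
have r01 : (\rank (S 0%N) <= \rank (S 1%N))%N by rewrite r0.
have := concave_upper conc h.+1 r01; rewrite r0 r1 !add0n subn0.
by have := rank_leq_row Y; nia.
Qed.

End TwistSpanBound.

(** * The extremal case of the twisted linear system *)

Section TwistedSystem.

Variables (K : fieldType) (sigma : {rmorphism K -> K}) (m e h : nat).
Variables (Y : 'M[K]_(m, e)) (B : 'M[K]_m).
Hypothesis B_unit : B \in unitmx.

Local Notation "Y ^[ j ]" := (twist sigma j Y) (at level 8, format "Y ^[ j ]").
Local Notation S j := (twist_span sigma j Y).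

Let M := Y^[h] + B *m Y^[h.+1].
Let W := (S h + M)%MS.

(** Since [B] is invertible, [Y^[h.+1]] can be recovered from [M] and [Y^[h]], so [W + S h.+1]
    contains [S h.+2]; the intersection of the two summands contains [S h]. *)
Lemma mxrank_twisted_system :
  (\rank (S h.+2) + \rank (S h) <= \rank W + \rank (S h.+1))%N.
Proof.
have SW : (S h.+2 <= W + S h.+1)%MS.
  have -> : S h.+2 = (S h.+1 + Y^[h.+1])%MS by [].
  rewrite addsmx_sub addsmxSr andTb.
  have -> : Y^[h.+1] = invmx B *m (M - Y^[h]) by rewrite addrC addKr mulKmx.
  apply: mulmx_sub; rewrite addmx_sub ?eqmx_opp //.
    exact: submx_trans (addsmxSr _ _) (addsmxSl _ _).
  exact: submx_trans (twist_sub_span _ _ (ltnSn h)) (addsmxSr _ _).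
have := mxrankS SW; have : (\rank (S h) <= \rank (W :&: S h.+1)%MS)%N.
  by rewrite mxrankS // sub_capmx !addsmxSl.
by have := mxrank_sum_cap W (S h.+1); lia.
Qed.

(* The rank hypotheses leave no slack: all the sums of twists involved are
   direct, so that Y^[h] and M have the same left kernel. *)
Lemma ker_twist_invariant t :
    (0 < h)%N -> (\rank W <= t * h.+1)%N ->
    (\rank (S h.+1) + t <= \rank (S h.+2))%N ->
  \rank Y = t /\ (kermx Y^[h] *m B <= kermx Y^[h.+1])%MS.
Proof.
move=> h0 Wt St.
have conc j := mxrank_twist_span_concave sigma j Y.
have r0 : \rank (S 0%N) = 0%N by rewrite mxrank0.
have r1 : \rank (S 1%N) = \rank Y by rewrite /= adds0mx.
have low := concave_lower conc St.
have sysr := mxrank_twisted_system.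
(* Concavity gives the lower bound t h; [sysr] together with the bound on [\rank W] gives the upper
   one. *)
have rh : \rank (S h) = (t * h)%N.
  by have := low 0%N h (leqW (leqW (leqnn h))); rewrite r0 !add0n; lia.
have rY : \rank Y = t.
  have := low 0%N 1%N isT; have := low 1%N h.-1.
  by rewrite add1n prednK // r0 r1 mul1n; nia.
have rW : \rank W = (t * h + t)%N by rewrite mulnS in Wt *; lia.
have r2 : (t * h + t + t <= \rank (S h.+2))%N.
  by have := low 0%N h.+2 (leqnn _); rewrite r0 !add0n; lia.
(* Adding this span to [S h] must raise the rank from t h to at least t (h + 2), so the bound 2t is
   attained and both sums are direct. *)
have rT : (\rank (Y^[h] + Y^[h.+1])%MS <= t + t)%N.
  by rewrite (leq_trans (mxrank_adds_leqif _ _)) // !mxrank_twist rY.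
have rSE : \rank (S h + (Y^[h] + Y^[h.+1]))%MS = \rank (S h.+2).
  by rewrite (addsmxA (S h)).
have capY : (Y^[h] :&: Y^[h.+1])%MS = 0.
  apply/eqP; rewrite -mxrank_eq0; have := mxrank_sum_cap Y^[h] Y^[h.+1].
  rewrite !mxrank_twist rY.
  have := mxrank_sum_cap (S h) (Y^[h] + Y^[h.+1])%MS.
  by rewrite rSE rh; lia.
have capM : (S h :&: M)%MS = 0.
  apply/eqP; rewrite -mxrank_eq0.
  have MT : (M <= Y^[h] + Y^[h.+1])%MS.
    by rewrite addmx_sub ?addsmxSl // mulmx_sub ?addsmxSr.
  have := mxrankS (capmxS (submx_refl (S h)) MT).
  have := mxrank_sum_cap (S h) (Y^[h] + Y^[h.+1])%MS.
  by rewrite rSE rh; lia.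
have rM : \rank M = t.
  by have := mxrank_disjoint_sum capM; rewrite -/W rW rh; lia.
(* If c M = 0 then c [Y^[h]] = - c B [Y^[h.+1]] lies in both row spaces, hence vanishes. Equality of
   ranks then gives the converse inclusion. *)
have kerMY : (kermx M <= kermx Y^[h])%MS.
  apply/sub_kermxP/eqP; rewrite -submx0 -capY sub_capmx.
  rewrite submxMl /=.
  have /eqP := mulmx_ker M; rewrite mulmxDr addr_eq0 mulmxA => /eqP ->.
  by rewrite eqmx_opp submxMl.
have kerYM : (kermx Y^[h] <= kermx M)%MS.
  rewrite -(geq_leqif (mxrank_leqif_sup kerMY)).
  by rewrite !mxrank_ker mxrank_twist rY rM.
split=> //; apply/sub_kermxP.
have /sub_kermxP := kerYM.
by rewrite mulmxDr mulmx_ker add0r mulmxA.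
Qed.

End TwistedSystem.

(** * The Frobenius map and Galois descent *)

Section Frobenius.

Variables (F : finFieldType) (L : fieldExtType F).
Local Notation q := #|F|.

Definition frobq (z : L) : L := z ^+ q.

Fact frobq_zmod_morphism : zmod_morphism frobq.
Proof.
move=> x y; have := frobenius_linear 1 (-1) y x.
by rewrite expn1 /= !scaleN1r ![- _ + _]addrC.
Qed.

Fact frobq_monoid_morphism : monoid_morphism frobq.
Proof. by split=> [|x y]; rewrite /frobq (expr1n, exprMn). Qed.

HB.instance Definition _ :=
  GRing.isZmodMorphism.Build L L frobq frobq_zmod_morphism.
HB.instance Definition _ :=
  GRing.isMonoidMorphism.Build L L frobq frobq_monoid_morphism.

Lemma twist_frobqE m e (Y : 'M[L]_(m, e)) j i k :
  twist frobq j Y i k = Y i k ^+ (q ^ j).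
Proof.
elim: j => [|j IHj] /=; first by rewrite expr1.
by rewrite mxE IHj /frobq -exprM expnSr.
Qed.

(** A fixed point is a root of X^q - X, which is the product of the X - a for a in F. *)
Lemma frobq_fixed z : frobq z = z -> exists a : F, z = a%:A.
Proof.
move=> zq; have := congr1 (map_poly (in_alg L)) (finField_genPoly F).
rewrite rmorphB /= map_polyXn map_polyX rmorph_prod /=.
move=> /(congr1 (horner^~ z)); rewrite /frobq in zq.
rewrite !hornerE horner_prod zq subrr => /esym/eqP.
rewrite prodf_seq_eq0 => /hasP [a _ /=].
rewrite rmorphB /= map_polyX map_polyC !hornerE subr_eq0 => /eqP ->.
by exists a.
Qed.

Lemma exp_card_dim (z : L) : z ^+ (q ^ \dim {:L}) = z.
Proof.
rewrite -[RHS](@expf_card (finvect_type L) z); congr (_ ^+ _).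
by have := card_vspace {: finvect_type L}; rewrite card_vspacef => ->.
Qed.

(** Galois descent: a relation over [L] between the columns of all twists, taken of minimal weight
    and normalised, has coefficients in [F], against the freeness of [X]. *)
Lemma twist_span_full m (X : seq {ffun 'I_m -> L}) (Y : 'M[L]_(m, size X)) :
    free X -> (forall i j, Y i j = X`_j i) ->
  \rank (twist_span frobq (\dim {:L}) Y) = size X.
Proof.
move=> freeX YX; set A := twist_span _ _ _.
apply/eqP; rewrite -mxrank_tr -[_ == _]/(row_free _) -kermx_eq0.
apply: contraT => /min_weight_exists [c cmin].
have [cN c0 cle] := cmin.
(* The twists are periodic: the one of order [\dim {:L}] is [Y] again. *)
have sAA : (map_mx frobq A <= A)%MS.
  apply: (@submx_trans _ _ _ _ _ _ (twist_span frobq (\dim {:L}).+1 Y)).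
    by rewrite (eqmxP (twist_spanS_map _ _ _)) addsmxSr.
  apply: twist_span_sub => j; rewrite ltnS leq_eqVlt.
  move=> /predU1P [->|/twist_sub_span //].
  have -> : twist frobq (\dim {:L}) Y = twist frobq 0 Y.
    by apply/matrixP => i k; rewrite twist_frobqE exp_card_dim.
  by rewrite twist_sub_span // adim_gt0.
have AsA : (A <= map_mx frobq A)%MS.
  by rewrite -(geq_leqif (mxrank_leqif_sup sAA)) mxrank_map.
have cA (d : 'rV_(size X)) : (d <= kermx A^T)%MS = (A *m d^T == 0).
  apply/sub_kermxP/eqP => [/(congr1 trmx)|/(congr1 trmx)].
    by rewrite trmx_mul trmxK trmx0.
  by rewrite trmx_mul trmxK trmx0.
have /rV0Pn [i ci] := c0.
pose d := (c 0 i)^-1 *: c.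
have di : d 0 i = 1 by rewrite mxE mulVf.
have dmin : min_weight (kermx A^T) d.
  split=> [||b bN b0]; first exact: scalemx_sub.
    by rewrite scaler_eq0 negb_or invr_eq0 ci.
  apply: leq_trans (cle _ bN b0); apply/subset_leq_card/subsetP => j.
  by rewrite !inE mxE mulf_eq0 negb_or => /andP [].
have [dN _ _] := dmin.
(* The Frobenius image of [d] is a relation supported where [d] is, hence a multiple of [d]; the
   entry 1 at [i] makes the factor 1. *)
have sd : map_mx frobq d = d.
  have sdN : (map_mx frobq d <= kermx A^T)%MS.
    have /submxP [P defA] := AsA.
    move: dN; rewrite !cA => /eqP dN.
    by rewrite defA -mulmxA map_trmx -map_mxM dN map_mx0 mulmx0.
  rewrite [LHS](min_weight_proportional (i := i) dmin _ sdN) ?di ?oner_eq0 //.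
    by rewrite mxE di rmorph1 divr1 scale1r.
  by move=> j dj; rewrite mxE dj rmorph0.
have /fin_all_exists [a da] : forall j, exists a : F, d 0 j = a%:A.
  move=> j; apply: frobq_fixed.
  by have := congr1 (fun b : 'rV_ _ => b 0 j) sd; rewrite mxE.
have Yd : Y *m d^T = 0.
  have YA : (Y <= A)%MS := twist_sub_span frobq Y (adim_gt0 {:L}%AS).
  have /submxP [P ->] := YA.
  by move: dN; rewrite cA -mulmxA => /eqP ->; rewrite mulmx0.
have ad : \sum_j a j *: X`_j = 0.
  apply/ffunP => k; rewrite sum_ffunE ffunE.
  have := congr1 (fun b : 'M_(_, _) => b k 0) Yd; rewrite !mxE => Yk.
  rewrite -[RHS]Yk; apply: eq_bigr => j _.
  by rewrite ffunE mxE da YX mulrC mulr_algl.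
have /freeP fX : free (in_tuple X) by [].
have := di; rewrite da fX // scale0r => /eqP.
by rewrite eq_sym oner_eq0.
Qed.

End Frobenius.

(** * Subspaces invariant under the twisted cyclic shift *)

Section ShiftInvariant.

Variables (F : finFieldType) (L : fieldExtType F) (m' : nat).
Local Notation m := m'.+1.
Local Notation q := #|F|.
Variable alpha : {ffun 'I_m -> L}.
Hypothesis alpha_neq0 : forall i, alpha i != 0.

Lemma cardF_gt0 : (0 < q)%N.
Proof. by apply/card_gt0P; exists 0. Qed.

Lemma entry_inZp (x : {ffun 'I_m -> L}) k : entry x k.+1 = x (inZp k).
Proof.
rewrite /entry addSn /= modnDr; case: insubP => [i _ ik|].
  by congr (x _); apply: val_inj.
by rewrite ltn_mod.
Qed.

Lemma ordS_inZp k : ordS (inZp k : 'I_m) = inZp k.+1.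
Proof. by apply: val_inj; rewrite /= -addn1 modnDml addn1. Qed.

Definition shift_twist (c : 'rV[L]_m) : 'rV[L]_m :=
  \row_i (c 0 (ordS i) ^+ q / alpha (ordS i)).

Lemma inZp_ord (i : 'I_m) : inZp i = i.
Proof. by apply: val_inj; rewrite /= modn_small. Qed.

(** Ordinals count from 0 and [entry] from 1, so [inZp i] carries the index i + 1. For k = m the
    shift closes up and the denominator is [Pi_ alpha i.+1]. *)
Lemma iter_shift_twistE k c i :
  iter k shift_twist c 0 (inZp i) =
  c 0 (inZp (i + k)) ^+ (q ^ k) /
    \prod_(0 <= j < k) entry alpha (i.+1 + j.+1) ^+ (q ^ j).
Proof.
elim: k i => [|k IHk] i; first by rewrite addn0 big_geq //= divr1.
rewrite iterS mxE !ordS_inZp IHk big_nat_recl // expr1 !addnS addn0 entry_inZp.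
rewrite expr_div_n -exprM -expnSr addSn invfM mulrA mulrAC; congr (_ / _ / _).
rewrite -prodrXl; apply: eq_bigr => j _.
by rewrite -exprM -expnSr; congr (entry _ _ ^+ _); lia.
Qed.

Lemma shift_denominator_neq0 k i :
  \prod_(0 <= j < k) entry alpha (i.+1 + j.+1) ^+ (q ^ j) != 0.
Proof.
rewrite prodf_seq_neq0; apply/allP => j _.
by rewrite addnS entry_inZp expf_neq0.
Qed.

Lemma PiE i :
  Pi_ alpha i.+1 = \prod_(0 <= j < m) entry alpha (i.+1 + j.+1) ^+ (q ^ j).
Proof. by rewrite /Pi_ big_add1; apply: eq_bigr => j _; rewrite subn1. Qed.

Lemma Pi_neq0 i : Pi_ alpha i.+1 != 0.
Proof. by rewrite PiE shift_denominator_neq0. Qed.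

(** The map only rotates supports, so it preserves minimality of the weight. *)
Lemma min_weight_shift_twist p (N : 'M[L]_(p, m)) k c :
    (forall d, (d <= N)%MS -> (shift_twist d <= N)%MS) ->
  min_weight N c -> min_weight N (iter k shift_twist c).
Proof.
move=> Nst cmin; elim: k => //= k; move: (iter _ _ _) => {cmin}c [cN c0 cle].
split=> [||d dN d0]; first exact: Nst.
  have /rV0Pn [i ci] := c0; apply/rV0Pn; exists (ord_pred i).
  by rewrite mxE ord_predK mulf_neq0 ?invr_eq0 ?expf_neq0.
apply: leq_trans (cle d dN d0); rewrite /weight -(card_image (@ordS_inj m)).
apply/subset_leq_card/subsetP => _ /imageP [i + ->]; rewrite !inE mxE.
by apply: contraNneq => ->; rewrite expr0n eqn0Ngt cardF_gt0 mul0r.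
Qed.

Hypothesis Pi_ratio : forall delta, (1 <= delta <= m - 1)%N ->
  ~ is_power (q ^ m - 1)%N (Pi_ alpha (delta + 2) / Pi_ alpha 2).

Lemma shift_invariant_full p (N : 'M[L]_(p, m)) :
    (forall d, (d <= N)%MS -> (shift_twist d <= N)%MS) ->
  N != 0 -> row_full N.
Proof.
move=> Nst /min_weight_exists [c0 /[dup] c0min [_ /rV0Pn [i0 c0i0] _]].
have iterE k (c : 'rV[L]_m) i : c 0 (inZp (i + k)) != 0 ->
    iter k shift_twist c 0 (inZp i) != 0.
  move=> ci; rewrite iter_shift_twistE mulf_neq0 ?expf_neq0 //.
  by rewrite invr_eq0 shift_denominator_neq0.
(* This many shifts bring the nonzero entry [i0] to coordinate [inZp 1], the one governed by
   [Pi_ alpha 2], with which the hypothesis compares. *)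
pose c := iter (i0 + m') shift_twist c0.
have c1 : c 0 (inZp 1) != 0.
  apply: iterE; rewrite addnCA add1n (_ : inZp _ = i0) //.
  by apply: val_inj; rewrite /= modnDr modn_small.
have cmin : min_weight N c by apply: min_weight_shift_twist.
have iterm i : iter m shift_twist c 0 (inZp i) =
    c 0 (inZp i) ^+ (q ^ m) / Pi_ alpha i.+1.
  rewrite iter_shift_twistE PiE; congr (c 0 _ ^+ _ / _).
  by apply: val_inj; rewrite /= modnDr.
have [iterN _ _] := min_weight_shift_twist m Nst cmin.
have qm : (q ^ m = (q ^ m - 1).+1)%N.
  by rewrite subn1 prednK // expn_gt0 cardF_gt0.
have prop : iter m shift_twist c =
    (iter m shift_twist c 0 (inZp 1) / c 0 (inZp 1)) *: c.
  apply: (min_weight_proportional cmin c1 iterN) => j cj.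
  by rewrite -(inZp_ord j) iterm inZp_ord cj expr0n qm mul0r.
(* A second nonzero entry, [delta] places further, would make [Pi_ (delta + 2) / Pi_ 2] the (q^m -
   1)-th power of the ratio of the two entries. *)
have supp i : c 0 i != 0 -> i = inZp 1.
  move=> ci; pose delta := ((i + m') %% m)%N.
  have di : inZp delta.+1 = i.
    apply: val_inj; rewrite /= -addn1 modnDml -addnA addn1 modnDr.
    by rewrite modn_small.
  case: (posnP delta) => [d0|d0]; first by rewrite -di d0.
  have dm : (1 <= delta <= m - 1)%N by rewrite d0 subn1 /= -ltnS ltn_mod.
  case: (Pi_ratio dm); exists (c 0 i / c 0 (inZp 1)).
  have := congr1 (fun b : 'rV_m => b 0 (inZp delta.+1)) prop.
  rewrite [RHS]mxE !iterm di addn2 expr_div_n qm !exprS -qm => eq_ci.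
  have P1 := Pi_neq0 delta.+1; have P2 := Pi_neq0 1.
  have -> : c 0 i ^+ (q ^ m - 1) =
      Pi_ alpha delta.+2 * (c 0 (inZp 1) ^+ (q ^ m - 1) / Pi_ alpha 2).
    apply: (mulfI ci); apply: (mulIf (invr_neq0 P1)); rewrite eq_ci.
    by field; apply/and3P.
  by field; rewrite P2 expf_neq0.
have weight1 k j1 j2 : iter k shift_twist c 0 j1 != 0 ->
    iter k shift_twist c 0 j2 != 0 -> j1 = j2.
  have [_ _ kle] := min_weight_shift_twist k Nst cmin.
  have [cN c_neq0 _] := cmin.
  have : (weight (iter k shift_twist c) <= 1)%N.
    apply: leq_trans (kle c cN c_neq0) _; rewrite -(card1 (inZp 1 : 'I_m)).
    by apply/subset_leq_card/subsetP => i; rewrite !inE => /supp ->.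
  by move=> /card_le1_eqP k1 c1' c2'; apply: k1; rewrite inE.
(* Shifting the single nonzero entry to each coordinate in turn puts every unit vector, up to a
   scalar, in [N]. *)
rewrite -sub1mx; apply/row_subP => i; rewrite row1.
pose d := iter (m.+1 - i) shift_twist c.
have di : d 0 i != 0.
  rewrite -[X in d 0 X]inZp_ord iterE // (_ : inZp _ = inZp 1) //.
  rewrite subnKC ?(ltnW (leqW (ltn_ord i))) //.
  by apply: val_inj; rewrite /= -addn1 modnDl.
have -> : delta_mx 0 i = (d 0 i)^-1 *: d.
  apply/rowP => j; rewrite [LHS]mxE [RHS]mxE /=.
  case: (eqVneq j i) => [->|ij]; first by rewrite mulVf.
  suff -> : d 0 j = 0 by rewrite mulr0.
  by apply: contraNeq ij => dj; rewrite (weight1 _ _ _ dj di).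
have [dN _ _] := min_weight_shift_twist (m.+1 - i) Nst cmin.
exact: scalemx_sub.
Qed.

End ShiftInvariant.

(** * Evasiveness of [V_ alpha h] from the rank dichotomy *)

Theorem theorem4p7 (q n m h : nat) (F : finFieldType) (L : fieldExtType F)
    (hq : #|F| = q) (hn : \dim {:L} = n)
    (hm : (3 <= m)%N) (hh : (2 <= h <= n - 2)%N)
    (alpha : {ffun 'I_m -> L}) (alpha_neq0 : forall i, alpha i != 0)
    (hK : ~ is_power (\sum_(0 <= i < m) q ^ i)%N (K_ alpha))
    (hPi : forall delta : nat, (1 <= delta <= m - 1)%N ->
       ~ is_power (q ^ m - 1)%N (Pi_ alpha (delta + 2) / Pi_ alpha 2)) :
  forall s : nat, (2 <= s <= m - 2)%N ->
    evasive (m * h.+1 - s * h.+1)%N (m * n - s.+1 * (n - h - 1))%N (V_ alpha h).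
Proof.
case: m => [//|m'] in hm alpha alpha_neq0 hK hPi *.
move=> s hs; subst q.
(* Additive parameters avoid truncated subtraction: g = n - h - 1 and u + 1 = m - s, the t of the
   overview. *)
have [g gE] : exists g, n = (h + 1 + g)%N by exists (n - h - 1)%N; lia.
have [u uE] : exists u, m'.+1 = (s + 1 + u)%N by exists (m' - s)%N; lia.
have h_gt0 : (0 < h)%N by lia.
have hr : (n - h - 1 = g)%N by lia.
have aE : (m'.+1 * h.+1 - s * h.+1 = u.+1 * h.+1)%N.
  by rewrite -mulnBl; congr (_ * _)%N; lia.
split; [by rewrite aE | rewrite aE; nia | rewrite aE hr; nia |].
move=> H; rewrite aE => dimH.
have VE x : linfun (V_vec alpha h) x = V_vec alpha h x by rewrite lfunE.
pose E := (linfun (V_vec alpha h) @^-1: restrict_scalars H)%VS.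
have dimE : (\dim (V_ alpha h :&: restrict_scalars H) <= \dim E)%N.
  rewrite -(limg_ker_dim (linfun (V_vec alpha h)) E).
  apply: leq_trans (leq_addl _ _).
  apply/dimvS/subvP => v; rewrite memv_cap => /andP [/V_P [x ->] xH].
  by rewrite -VE memv_img // -memv_preim VE.
apply: leq_trans dimE _.
pose X : seq _ := vbasis E; have sX : size X = \dim E by rewrite size_tuple.
have freeX : free X := basis_free (vbasisP E).
pose Y := \matrix_(i < m'.+1, j < size X) X`_j i.
pose sh := perm (@ordS_inj m'.+1).
pose B := perm_mx sh *m diag_mx (\row_i alpha i).
have BE p (Z : 'M[L]_(p, m'.+1)) k i :
    (Z *m B) k (ordS i) = Z k i * alpha (ordS i).
  rewrite mulmxA mul_mx_diag [LHS]mxE [X in _ * X]mxE -[sh]invgK -col_permE mxE.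
  by rewrite -[X in Z k (_ X)](permE (@ordS_inj m'.+1)) permK.
have B_unit : B \in unitmx.
  rewrite unitmx_mul unitmx_perm unitmxE det_diag unitfE.
  by apply/prodf_neq0 => i _; rewrite mxE.
pose VT := \matrix_(t < m'.+1 * h.+1, j < size X) V_vec alpha h X`_j t.
(* All columns of [VT] lie in H, so [VT] factors through a basis of H. *)
have rVT : (\rank VT <= u.+1 * h.+1)%N.
  rewrite -dimH; set b := vbasis H.
  have -> : VT = (\matrix_(t < m'.+1 * h.+1, i < \dim H) b`_i 0 t) *m
      \matrix_(i < \dim H, j < size X) coord b i (row_of (V_vec alpha h X`_j)).
    apply/matrixP => t j; rewrite !mxE.
    have XH : row_of (V_vec alpha h X`_j) \in H.
      rewrite -mem_restrict_scalars -VE memv_preim.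
      by apply: vbasis_mem; apply: mem_nth.
    have := congr1 (fun v : 'rV_(m'.+1 * h.+1) => v 0 t) (coord_vbasis XH).
    rewrite mxE => ->; rewrite summxE; apply: eq_bigr => i _.
    by rewrite !mxE mulrC.
  exact: mulmx_max_rank.
have index j (i : 'I_m'.+1) : (j <= h)%N ->
    exists2 t : 'I_(m'.+1 * h.+1), (t %/ m'.+1 = j)%N & (t %% m'.+1 = i)%N.
  move=> jh; have tm : (j * m'.+1 + i < m'.+1 * h.+1)%N.
    rewrite [ltnRHS]mulnC (@leq_trans (j.+1 * m'.+1)) ?leq_mul2r //.
    by rewrite mulSn addnC ltn_add2r.
  exists (Ordinal tm); rewrite /= ?modnMDl ?modn_small //.
  by rewrite divnMDl // divn_small ?addn0.
pose M := twist (@frobq F L) h Y + B *m twist (@frobq F L) h.+1 Y.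
pose W := (twist_span (@frobq F L) h Y + M)%MS.
have rW : (\rank W <= u.+1 * h.+1)%N.
  apply: leq_trans rVT; apply: mxrankS; rewrite addsmx_sub; apply/andP; split.
    apply: twist_span_sub => j jh; apply/row_subP => i.
    have [t tj ti] := index j i (ltnW jh).
    suff -> : row i (twist (@frobq F L) j Y) = row t VT by apply: row_sub.
    apply/rowP => k; rewrite [LHS]mxE twist_frobqE !mxE ffunE /= tj ti jh.
    by rewrite entry_inZp inZp_ord.
  apply/row_subP => i; have [t tj ti] := index h i (leqnn h).
  suff -> : row i M = row t VT by apply: row_sub.
  apply/rowP => k; rewrite [LHS]mxE [LHS]mxE twist_frobqE.
  rewrite [in RHS]mxE [in RHS]mxE ffunE /= tj ti ltnn /f_ !entry_inZp.
  rewrite -ordS_inZp inZp_ord.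
  congr (_ + _); first by rewrite mxE.
  rewrite /B -mulmxA -row_permE mul_diag_mx [LHS]mxE.
  rewrite permE [LHS]mxE [X in X * _]mxE; congr (_ * _).
  by rewrite -[LHS]/(twist _ h.+1 Y _ _) twist_frobqE mxE.
have rX : \rank (twist_span (@frobq F L) n Y) = size X.
  by rewrite -hn; apply: twist_span_full => // i j; rewrite mxE.
rewrite -sX -rX hr.
case: (leqP (\rank (twist_span (@frobq F L) h.+1 Y) + u.+1)
            (\rank (twist_span (@frobq F L) h.+2 Y))) => rank_step; last first.
  have hn' : (h < n)%N by lia.
  have step : (\rank (twist_span (@frobq F L) h.+2 Y) <=
      \rank (twist_span (@frobq F L) h.+1 Y) + u)%N by lia.
  have := mxrank_twist_span_bound hn' step.
  rewrite (_ : (n - h.+1)%N = g); last by lia.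
  suff -> : (m'.+1 * n - s.+1 * g = m'.+1 * h.+1 + g * u)%N by [].
  by apply: (canLR (addnK _)); rewrite uE gE; lia.

have [rY kerB] := ker_twist_invariant B_unit h_gt0 rW rank_step.
set N := kermx (twist (@frobq F L) h Y) in kerB.
have rN : \rank N = s by rewrite mxrank_ker mxrank_twist rY; lia.
(* [kerB] is the opposite inclusion; both sides have rank s, so they coincide. *)
have NsN : (map_mx (@frobq F L) N <= N *m B)%MS.
  rewrite map_kermx in kerB *.
  rewrite -(geq_leqif (mxrank_leqif_sup kerB)) mxrankMfree ?row_free_unit //.
  by rewrite rN mxrank_ker !mxrank_twist rY; lia.
(* By [BE], [shift_twist alpha d] is the Frobenius image of [d] times the inverse of [B]. *)
have Nst (d : 'rV_m'.+1) : (d <= N)%MS -> (shift_twist alpha d <= N)%MS.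
  rewrite -(map_submx (@frobq F L)) => /submx_trans /(_ NsN) /submxP [P dP].
  suff -> : shift_twist alpha d = P *m N by apply: submxMl.
  apply/rowP => i; rewrite mxE; apply: (canLR (mulfK (alpha_neq0 _))).
  by rewrite -BE -mulmxA -dP mxE.
have N0 : N != 0 by rewrite -mxrank_eq0 rN; lia.
have := shift_invariant_full alpha_neq0 hPi Nst N0.
by rewrite /row_full rN; lia.
Qed.
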